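(* Let $m\ge1$ be a fixed integer and let $a_n$ be the number of compositions of $n$ having no $m$-congruence successions. Let $$H_m(x)=1-\sum_{a=1}^m\frac{x^a}{1+x^a-x^m},$$ and let $\rho_m$ be the smallest positive real zero of $H_m$. Then, as $n\to\infty$, $$a_n\sim\rho_m^{-n}\,\frac{1}{-\rho_m H_m'(\rho_m)}.$$
   Context: A composition of a positive integer $n$ is a sequence $\sigma_1\sigma_2\cdots\sigma_d$ of positive integers with sum $n$ (any number $d$ of parts). An $m$-congruence succession is an index $1\le i\le d-1$ with $\sigma_{i+1}\equiv\sigma_i\pmod m$. The notation $u_n\sim v_n$ means $u_n/v_n\to1$ as $n\to\infty$. *)

(* Defs.v *)
From mathcomp Require Import all_boot all_order all_algebra finmap.
From mathcomp Require Import all_classical all_reals all_analysis.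

Set Implicit Arguments.
Unset Strict Implicit.
Unset Printing Implicit Defensive.

Import Order.TTheory GRing.Theory Num.Theory.
Import numFieldNormedType.Exports.

Local Open Scope classical_set_scope.
Local Open Scope ring_scope.

Definition is_composition (n : nat) (s : seq nat) : bool :=
  all (fun part => (0 < part)%N) s && (sumn s == n).

(* Parts are numbered from 0, so i ranges over 0 <= i < size s - 1. *)
Definition congruence_succession (m : nat) (s : seq nat) (i : nat) : bool :=
  (i.+1 < size s)%N && (nth 0%N s i.+1 == nth 0%N s i %[mod m])%N.

Definition succession_free_compositions (m n : nat) : set (seq nat) :=
  [set s | is_composition n s /\ forall i, ~~ congruence_succession m s i].

(* fset_set sends infinite sets to the empty one; finiteness is
   finite_succession_free_compositions. *)
Definition num_succession_free (m n : nat) : nat :=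
  #|` fset_set (succession_free_compositions m n)|.

Lemma finite_succession_free_compositions (m n : nat) :
  finite_set (succession_free_compositions m n).
Proof.
pose f (b : n.-bseq 'I_n.+1) : seq nat := map (@nat_of_ord n.+1) b.
apply: (@sub_finite_set _ _ (f @` setT)); last first.
  exact/finite_image/finite_finset.
move=> s [/andP[spos /eqP sn] _].
have sle : forall t : seq nat, all (fun p => (0 < p)%N) t ->
    (size t <= sumn t)%N.
  elim=> [//|a t IH] /= /andP[a0 /IH]; rewrite -add1n; exact: leq_add.
have ple : forall (t : seq nat) p, p \in t -> (p <= sumn t)%N.
  elim=> [//|a t IH] p /=; rewrite inE => /orP[/eqP->|/IH pt].
    exact: leq_addr.
  exact: leq_trans pt (leq_addl _ _).
have sz : (size (map (@inord n) s) <= n)%N by rewrite size_map; have := sle s spos; rewrite sn.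
exists (Bseq sz) => //; rewrite /f /= -map_comp -[RHS]map_id.
by apply/eq_in_map => p ps /=; rewrite inordK // ltnS -sn ple.
Qed.

Section SuccessionFreeDenominator.
Variable R : realType.

Definition H (m : nat) (x : R) : R :=
  1 - \sum_(1 <= a < m.+1) x ^+ a / (1 + x ^+ a - x ^+ m).

(* Division is total, so H also takes values at its poles. This does not affect
   the smallest positive zero: the denominators are positive on [0, 1], and H
   has a zero in ]0, 1] (see smallest_positive_zero_exists). *)
Definition is_smallest_positive_zero (f : R -> R) (r : R) : Prop :=
  [/\ 0 < r, f r = 0 & forall x, 0 < x -> f x = 0 -> r <= x].

Definition asymp_equiv (u v : nat -> R) : Prop :=
  (fun n => u n / v n) @ \oo --> (1 : R).

Lemma H_denom_gt0 (m a : nat) (x : R) : (0 < a <= m)%N -> 0 <= x <= 1 ->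
  0 < 1 + x ^+ a - x ^+ m.
Proof.
move=> /andP[a0 am] /andP[x0 x1]; have [->|xn1] := eqVneq x 1.
  by rewrite !expr1n addrK.
have xlt : x < 1 by rewrite lt_neqAle xn1.
rewrite -addrA (lt_le_trans ltr01)// lerDl subr_ge0.
exact: ler_wiXn2l.
Qed.

Lemma continuous_H (m : nat) (x : R) : 0 <= x <= 1 -> {for x, continuous (H m)}.
Proof.
move=> x01; rewrite /prop_for /continuous_at /H.
apply: cvgB; first exact: cvg_cst.
rewrite big_nat; under eq_cvg do rewrite big_nat.
apply: cvg_big => [|a am]; first exact: add_continuous.
apply: cvgM; first exact: exprn_continuous.
apply: cvgV; first by rewrite gt_eqF// H_denom_gt0.
apply: cvgB; last exact: exprn_continuous.
apply: cvgD; first exact: cvg_cst.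
exact: exprn_continuous.
Qed.

Lemma smallest_positive_zero_exists (m : nat) : (0 < m)%N ->
  exists2 r : R, r <= 1 & is_smallest_positive_zero (H m) r.
Proof.
move=> m0.
have H0 : H m 0 = 1.
  rewrite /H big_nat big1 ?subr0// => a /andP[a0 _].
  by rewrite expr0n eqn0Ngt a0 mul0r.
have H1 : H m 1 = 1 - m%:R.
  rewrite /H; under eq_bigr do rewrite !expr1n addrK divr1.
  by rewrite big_const_nat subn1 iter_addr_0.
pose Z := [set x : R | 0 <= x <= 1 /\ H m x = 0].
have Z0 : Z !=set0.
  have [||c] := @IVT R (H m) 0 1 0 ler01.
  - apply: continuous_in_subspaceT => x; rewrite inE /= in_itv /=.
    exact: continuous_H.
  - rewrite H0 H1 minEle maxEle; have : 1 - m%:R <= 0 :> R.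
      by rewrite subr_le0 ler1n.
    case: ifPn => [h1 h2|_ ->]; last by rewrite ler01.
    by have := le_trans h1 h2; rewrite ler10.
  - by rewrite in_itv /= => c01 Hc; exists c.
have Zlb : has_lbound Z by exists 0 => x [/andP[]].
have ZI : has_inf Z by split.
set r := inf Z.
have r0 : 0 <= r by apply: lb_le_inf => // x [/andP[]].
have r1 : r <= 1.
  case: Z0 => z Zz; apply: le_trans (_ : z <= 1); last by case: Zz => /andP[].
  exact: ge_inf.
have Hr : H m r = 0.
  apply/eqP/negPn/negP => Hr.
  have r01 : 0 <= r <= 1 by rewrite r0.
  have : \forall x \near r, H m x != 0.
    exact: (continuous_H r01 (open_nbhs_nbhs (conj (@open_neq _ 0) Hr))).
  move=> /nbhs_ballP[e /= e0 he].
  have [z Zz zr] := inf_adherent e0 ZI.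
  have rz : r <= z by exact: ge_inf.
  have /he : ball r e z.
    by rewrite -ball_normE /= distrC ger0_norm ?subr_ge0// ltrBlDl.
  by case: Zz => _ ->; rewrite eqxx.
exists r => //; split => //.
  by rewrite lt_neqAle r0 andbT; apply/eqP => r0'; move: Hr;
    rewrite -r0' H0 => /eqP; rewrite oner_eq0.
move=> x x0 Hx; have [x1|/ltW x1] := leP x 1; last exact: le_trans x1.
by apply: ge_inf => //; split; rewrite ?(ltW x0).
Qed.

End SuccessionFreeDenominator.

(* Main.v *)
Require Import Defs.
From mathcomp Require Import all_boot all_order all_algebra finmap.
From mathcomp Require Import all_classical all_reals all_analysis.
From mathcomp Require Import ring lra zify.

Import Order.TTheory GRing.Theory Num.Theory.
Import numFieldNormedType.Exports.

(* Let A_r(n) count the succession-free compositions of n whose first part is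
   congruent to r mod m, and B_r(n) the others. Lowering a first part > m by m,
   or deleting a first part equal to r, gives
     A_r(n) = A_r(n - m) + B_r(n - r),  B_r(n) = [n = 0] + sum_(s <> r) A_s(n).
   With p = rho^m and q_r = rho^r / (1 + rho^r - rho^m), so that sum_r q_r = 1
   because H(rho) = 0, the scaled counts alpha_r = A_r rho^n / q_r and
   beta_r = B_r rho^n / (1 - q_r) satisfy
     alpha_r(n) = p alpha_r(n - m) + (1 - p) beta_r(n - r),
     beta_r(n) = sum_(s <> r) q_s / (1 - q_r) alpha_s(n)  for n > 0,
   which are convex combinations. The system is irreducible and aperiodic for
   m >= 2, so all alpha_r and beta_r converge to a common limit, by contraction
   of the oscillation. A conserved quantity identifies that limit. *)

(** * Recurrences for the counts by residue class of the first part *)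

Section Counting.
Variable m : nat.
Hypothesis m_gt0 : (0 < m)%N.

Definition incongruent (a b : nat) := (a != b %[mod m])%N.

Definition succession_free (s : seq nat) : bool :=
  all (fun a => (0 < a)%N) s && sorted incongruent s.

(* The compositions of n - m, and none if n < m: this shift by m keeps
   the recurrences valid for every n, without truncated subtraction. *)
Definition padded_compositions (n : nat) : seq (seq nat) :=
  if (n < m)%N then [::]
  else enum_fset (fset_set (succession_free_compositions m (n - m))).

Lemma uniq_padded n : uniq (padded_compositions n).
Proof. by rewrite /padded_compositions; case: ifP => // _; exact: fset_uniq. Qed.

Lemma mem_padded n s :
  (s \in padded_compositions n) = succession_free s && (sumn s + m == n).
Proof.
rewrite /padded_compositions; case: ltnP => nm.
  by rewrite in_nil; apply/esym/andP => -[_ /eqP]; lia.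
rewrite -[LHS]/(s \in fset_set _) in_fset_set; last first.
  exact: finite_succession_free_compositions.
apply/idP/idP.
  rewrite inE => -[/andP[s0 /eqP sn] hs].
  rewrite /succession_free s0 sn subnK// eqxx andbT/=.
  apply/(sortedP 0) => i si; have := hs i.
  by rewrite /congruence_succession si /= eq_sym.
case/andP => /andP[s0 ss] /eqP sn; rewrite inE; split.
  by rewrite /is_composition s0 -sn addnK eqxx.
move=> i; rewrite /congruence_succession; case: ltnP => //= si.
by rewrite eq_sym; exact: (sortedP 0 ss).
Qed.

(** False on the empty sequence, so that [predC (starts r)] contains the empty composition; this is
    the term [n = 0] of B_r. *)
Definition starts (r : nat) (s : seq nat) : bool :=
  if s is a :: _ then (a == r %[mod m])%N else false.

Lemma succession_free_cons r s : (0 < r)%N ->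
  succession_free (r :: s) = succession_free s && ~~ starts r s.
Proof.
move=> r0; rewrite /succession_free /= r0 /=.
case: s => [//|a s] /=; rewrite /incongruent (eq_sym (a %% m)%N) -!andbA.
by congr andb; congr andb; rewrite andbC.
Qed.

Definition lift_head (s : seq nat) := if s is a :: t then (a + m)%N :: t else s.

Lemma lift_head_inj : injective lift_head.
Proof. by move=> [|a s] [|b t] //= [/addIn -> ->]. Qed.

(** Without padding: A_r(n) = A_r(n - m) + B_r(n - r). [lift_head] yields the compositions with
    first part above m; prepending [r] yields those with first part at most m, hence equal to
    [r]. *)
Lemma count_starts_rec r n : (0 < r <= m)%N ->
  count (starts r) (padded_compositions (n + m)) =
  (count (starts r) (padded_compositions n)
   + count (predC (starts r)) (padded_compositions (n + (m - r))))%N.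
Proof.
move=> /andP[r0 rm]; rewrite -!size_filter.
set X := seq.filter _ (padded_compositions n).
set Y := seq.filter (predC _) _.
rewrite -(size_map lift_head X) -(size_map (cons r) Y) -size_cat.
apply/perm_size/uniq_perm.
- by rewrite filter_uniq ?uniq_padded.
- rewrite cat_uniq !map_inj_uniq ?filter_uniq ?uniq_padded ?andbT//=.
  + apply/hasPn => _ /mapP[t tY ->]; apply/mapP => -[[|a s] //=].
    rewrite mem_filter mem_padded /succession_free /= => /andP[_].
    by case/andP => /andP[/andP[a0 _] _] _ [] ; lia.
  + by move=> s t [].
  + exact: lift_head_inj.
move=> s; rewrite mem_filter mem_padded mem_cat.
have inX a t : ((a :: t) \in X) =
    [&& starts r (a :: t), succession_free (a :: t) & (sumn (a :: t) + m == n)%N].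
  by rewrite mem_filter mem_padded.
have inY t : (t \in Y) =
    [&& ~~ starts r t, succession_free t & (sumn t + r == n)%N].
  rewrite mem_filter mem_padded /=; do 2!congr andb.
  by apply/eqP/eqP; lia.
have -> : (s \in map lift_head X) =
    [&& starts r s, succession_free s, (sumn s == n)%N & (m < head 0 s)%N].
  apply/mapP/idP => [[[|a t]]|]; first by rewrite mem_filter.
    rewrite inX => /and3P[/= h1 /andP[/andP[a0 h3] h2] /eqP h4] ->.
    apply/and4P; split => /=; [by rewrite modnDr| |by apply/eqP; lia|by lia].
    apply/andP; split; first by apply/andP; split; [lia|exact: h3].
    by case: t h2 {h3 h4} => [//|b t] /=; rewrite /incongruent modnDr.
  case: s => [//|a t] /= /and4P[h1 h2 /eqP h3 h4]; exists ((a - m)%N :: t).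
    rewrite inX; apply/and3P; split => /=.
    + by rewrite -[X in X %% _ == _]addn0 -(modnn m) modnDmr subnK// ltnW.
    + move: h2; rewrite /succession_free /= => /andP[/andP[_ ->] h2].
      rewrite subn_gt0 h4 /=; case: t h2 {h3} => [//|b t] /=.
      by rewrite /incongruent -{1}(subnK (ltnW h4)) modnDr.
    + by apply/eqP; lia.
  by rewrite /= subnK// ltnW.
have -> : (s \in map (cons r) Y) =
    [&& starts r s, succession_free s, (sumn s == n)%N & (head 0 s <= m)%N].
  apply/mapP/idP => [[t]|].
    rewrite inY => /and3P[h1 h2 /eqP h3] ->.
    by rewrite succession_free_cons// h1 h2 rm /= eqxx andbT; apply/eqP; lia.
  case: s => [//|a t] /= /and4P[h1 h2 /eqP h3 h4].
  (* Both lie in 1..m, so their predecessors are reduced residues; this treats r = m like the other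
     classes. *)
  have ar : a = r.
    have a0 : (0 < a)%N by move: h2 => /andP[/= /andP[]].
    move: h1; rewrite -[a](prednK a0) -[r](prednK r0) -!(addn1 _.-1) eqn_modDr.
    by rewrite !modn_small; [lia | lia | lia].
  rewrite ar; exists t => //; move: h2; rewrite ar succession_free_cons//.
  by move=> /andP[h2 h5]; rewrite inY h5 h2 /=; apply/eqP; lia.
rewrite eqn_add2r; case: starts => //=; case: succession_free => //=.
by case: eqP => //= _; case: ltnP.
Qed.

(** A nonempty composition starts in exactly one class [s.+1] with s < m. The empty one sits at
    padded index m and gives the last term. *)
Lemma count_starts_disjoint (r : 'I_m) n :
  count (predC (starts r.+1)) (padded_compositions n) =
  (\sum_(s < m | s != r) count (starts s.+1) (padded_compositions n)
   + (n == m))%N.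
Proof.
have -> : ((n == m) : nat) = count (pred1 [::]) (padded_compositions n).
  rewrite count_uniq_mem ?uniq_padded// mem_padded /succession_free /=.
  by rewrite add0n eq_sym.
have : all (fun s => all (fun a => 0 < a) s)%N (padded_compositions n).
  by apply/allP => s; rewrite mem_padded => /andP[/andP[]].
elim: padded_compositions => [|s l IH] /=; first by rewrite big1.
case/andP => s0 /IH ->; rewrite big_split /=.
suff -> : (~~ starts r.+1 s : nat) =
    (\sum_(i < m | i != r) starts i.+1 s + (s == [::]))%N by rewrite addnACA.
case: s s0 => [|a s] /=; first by rewrite big1.
case/andP=> a0 _; rewrite addn0.
have am : (a.-1 %% m < m)%N by rewrite ltn_mod.
have st (i : 'I_m) : (a == i.+1 %[mod m]) = (i == Ordinal am).
  rewrite -{1}(prednK a0) -!(addn1 _.-1) -(addn1 i) eqn_modDr (modn_small (ltn_ord i)).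
  by rewrite eq_sym.
rewrite st eq_sym; under eq_bigr do rewrite st.
have [e|ne] := eqVneq (Ordinal am) r.
  by rewrite big1// => i; rewrite e => /negPf ->.
by rewrite (bigD1 (Ordinal am))//= eqxx big1// => i /andP[_ /negPf ->].
Qed.

End Counting.

(** * Convergence of averaging recurrences *)

Local Open Scope ring_scope.

(** Row i has lags m and [i.+1]: the shape of the alpha recurrence once beta is eliminated. *)
Definition averaging_rec {R : realType} {m : nat} (p : R) (w : 'I_m -> 'I_m -> R)
    (x : nat -> 'I_m -> R) :=
  forall n i, x (n + m)%N i = p * x n i + \sum_j w i j * x (n + (m - i.+1))%N j.

Section Averaging.
Variables (R : realType) (k : nat).
Local Notation m := k.+2.
Variables (p d : R) (w : 'I_m -> 'I_m -> R).
Hypotheses (p_ge0 : 0 <= p) (w_ge0 : forall i j, 0 <= w i j).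
Hypothesis w1 : forall i, p + \sum_j w i j = 1.
Hypotheses (d_gt0 : 0 < d) (dp : d <= p).
Hypothesis dw : forall i j, i != j -> d <= w i j.

Local Notation rec := (averaging_rec p w).

Lemma averaging_rec_shift x N : rec x -> rec (fun n => x (N + n)%N).
Proof. by move=> hx n i; rewrite addnA hx; under eq_bigr do rewrite -addnA. Qed.

(** Constants are solutions because the weights sum to 1. Two-sided bounds thus reduce to
    nonnegativity. *)
Lemma averaging_rec_affine x a c : rec x -> rec (fun n i => a * x n i + c).
Proof.
move=> hx n i; rewrite hx /=.
under [in RHS]eq_bigr do rewrite mulrDr mulrCA.
rewrite big_split /= -mulr_sumr -mulr_suml; have := w1 i.
move: (\sum_j w i j * _) (\sum_j w i j) => s t pt.
by have -> : t = 1 - p; [rewrite -pt addrC addKr|ring].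
Qed.

Lemma averaging_ge0 x : rec x -> (forall n i, (n < m)%N -> 0 <= x n i) ->
  forall n i, 0 <= x n i.
Proof.
move=> hx x0 n; have [N] := ubnP n; elim: N n => // N IH n nN i.
have [/x0//|mn] := ltnP n m.
rewrite -(subnK mn) hx addr_ge0 ?mulr_ge0 ?IH ?sumr_ge0 //; first by lia.
by move=> j _; rewrite mulr_ge0 ?IH//; have := ltn_ord i; lia.
Qed.

(** Encodes a path of duration T from state 0 to i by its effect on nonnegative solutions. The
    origin is time m, from which on the recurrence gives every value. *)
Definition reaches T i := forall x, rec x -> (forall n j, 0 <= x n j) ->
  d ^+ T * x m ord0 <= x (m + T)%N i.

Lemma min_weight_le1 : d <= 1.
Proof. by rewrite (le_trans dp)// -(w1 ord0) lerDl sumr_ge0. Qed.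

(** The loop at i lasts m steps and has weight p >= d. As d <= 1, the exponent may count time
    instead of edges. *)
Lemma reaches_loop T i : reaches T i -> reaches (T + m) i.
Proof.
move=> r x hx x0; rewrite addnA hx.
apply: le_trans (_ : p * x (m + T)%N i <= _); last first.
  by rewrite lerDl sumr_ge0// => j _; rewrite mulr_ge0.
apply: le_trans (_ : d * (d ^+ T * x m ord0) <= _); last first.
  by rewrite ler_pM ?mulr_ge0 ?exprn_ge0 ?r// ltW.
rewrite mulrA -exprS ler_wpM2r// ler_wiXn2l ?min_weight_le1 ?ltW//; lia.
Qed.

Lemma reaches_step T i j : i != j -> reaches T j -> reaches (T + i.+1) i.
Proof.
move=> ij r x hx x0; have -> : (m + (T + i.+1) = (T + i.+1) + m)%N by lia.
rewrite hx; apply: le_trans (_ : w i j * x (m + T)%N j <= _); last first.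
  have -> : (T + i.+1 + (m - i.+1) = m + T)%N by have := ltn_ord i; lia.
  rewrite (bigD1 j)//= [leRHS]addrCA lerDl addr_ge0 ?mulr_ge0// sumr_ge0// => l _.
  by rewrite mulr_ge0.
apply: le_trans (_ : d * (d ^+ T * x m ord0) <= _); last first.
  by rewrite ler_pM ?mulr_ge0 ?exprn_ge0 ?r ?dw// ltW.
rewrite mulrA -exprS ler_wpM2r// ler_wiXn2l ?min_weight_le1 ?ltW//; lia.
Qed.

(* The state 0 returns to itself after m steps (loop) and after m + 1 steps
   (through the state m - 1), which are coprime. *)
Lemma reaches0 T : (m * m <= T)%N -> reaches T ord0.
Proof.
move=> mT; have ht := ltn_pmod T (isT : (0 < m)%N).
(* This makes room for T mod m rounds of length m + 1, the remaining time being a multiple of m. *)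
have qT : (T %% m <= T %/ m)%N by rewrite (leq_trans (ltnW ht))// leq_divRL.
have [a ea] : exists a, (T %/ m = T %% m + a)%N.
  by exists (T %/ m - T %% m)%N; rewrite subnKC.
have -> : T = ((T %% m) * m.+1 + a * m)%N.
  by have := divn_eq T m; rewrite ea; move: (T %% m)%N => b; lia.
elim: a {ea} => [|a IH]; last by rewrite mulSnr addnA; exact: reaches_loop.
rewrite mul0n addn0; elim: (_ %% _)%N => [|b IH].
  by move=> x _ _; rewrite mul0n addn0 expr0 mul1r.
have -> : (b.+1 * m.+1 = b * m.+1 + (@ord_max m.-1).+1 + (@ord0 m.-1).+1)%N.
  by rewrite /=; lia.
apply: (@reaches_step _ _ ord_max) => //; exact: (@reaches_step _ _ ord0).
Qed.

Lemma reaches_all T i : (m * m + m <= T)%N -> reaches T i.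
Proof.
move=> mT; have [->|i0] := eqVneq i ord0; first by apply: reaches0; lia.
have -> : (T = (T - i.+1) + i.+1)%N by have := ltn_ord i; lia.
by apply: (@reaches_step _ _ ord0) => //; apply: reaches0; have := ltn_ord i; lia.
Qed.

Let T0 := (m * m + m)%N.
Let c := d ^+ (T0 + m).

(** For the first m values of n this is [reaches_all], with [c] small enough for the whole window;
    it persists because a solution minus a constant is a solution. *)
Lemma averaging_gain x : rec x -> (forall n j, 0 <= x n j) ->
  forall n i, c * x m ord0 <= x (m + T0 + n)%N i.
Proof.
move=> hx x0 n i.
pose y n i := 1 * x ((m + T0) + n)%N i + - (c * x m ord0).
suff : 0 <= y n i by rewrite /y mul1r subr_ge0.
apply: averaging_ge0 => [|{}n {}i nm].
  exact/averaging_rec_affine/averaging_rec_shift.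
rewrite /y mul1r subr_ge0 -addnA.
apply: le_trans (_ : d ^+ (T0 + n) * x m ord0 <= _); last first.
  by apply: reaches_all => //; lia.
by rewrite ler_wpM2r// ler_wiXn2l ?min_weight_le1 ?ltW//; lia.
Qed.

Lemma gain_bounds : 0 < c <= 1.
Proof. by rewrite exprn_gt0// exprn_ile1 ?min_weight_le1// ltW. Qed.

Lemma averaging_contract x l h : rec x -> (forall n j, l <= x n j <= h) ->
  exists l' h', h' - l' = (1 - c) * (h - l) /\
    forall n i, l' <= x (m + T0 + n)%N i <= h'.
Proof.
move=> hx xlh; set a := x m ord0.
(* The gain is applied to x - l and h - x; the two moves add up to c (h - l) whatever a is. *)
exists (l + c * (a - l)), (h - c * (h - a)); split; first by ring.
move=> n i; apply/andP; split.
  have xl n' j : 0 <= 1 * x n' j + - l.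
    by rewrite mul1r subr_ge0; case/andP: (xlh n' j).
  by have := averaging_gain _ (averaging_rec_affine _ 1 (- l) hx) xl n i; rewrite -/a; lra.
have xh n' j : 0 <= - 1 * x n' j + h.
  by rewrite mulN1r addrC subr_ge0; case/andP: (xlh n' j).
by have := averaging_gain _ (averaging_rec_affine _ (-1) h hx) xh n i; rewrite -/a; lra.
Qed.

Lemma averaging_bounded x : rec x -> exists K, forall n j, - K <= x n j <= K.
Proof.
move=> hx; pose K := \sum_(n < m) \sum_j `|x n j|.
have xK n j : (n < m)%N -> `|x n j| <= K.
  move=> nm; rewrite /K (bigD1 (Ordinal nm))//= (bigD1 j)//= -addrA lerDl.
  by rewrite addr_ge0// ?sumr_ge0// => ? _; rewrite sumr_ge0.
exists K => n j; apply/andP; split.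
  have := averaging_ge0 _ (averaging_rec_affine _ 1 K hx) _ n j.
  rewrite mul1r -lerBlDr sub0r; apply => n' j' /(xK _ j').
  by rewrite ler_norml mul1r => /andP[h _]; rewrite -lerBlDr sub0r.
have := averaging_ge0 _ (averaging_rec_affine _ (-1) K hx) _ n j.
rewrite mulN1r addrC subr_ge0; apply => n' j' /(xK _ j').
by rewrite ler_norml mulN1r => /andP[_ h]; rewrite addrC subr_ge0.
Qed.

Lemma averaging_squeeze x : rec x -> exists D, forall t, exists l h N,
  h - l = (1 - c) ^+ t * D /\ forall n i, l <= x (N + n)%N i <= h.
Proof.
move=> hx; have [K xK] := averaging_bounded _ hx; exists (K - - K).
elim=> [|t [l [h [N [e lh]]]]].
  by exists (- K), K, 0%N; split => [|n i]; rewrite ?expr0 ?mul1r.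
have [l' [h' [e' lh']]] := averaging_contract _ _ _ (averaging_rec_shift _ N hx) lh.
exists l', h', (N + (m + T0))%N; split => [|n i]; first by rewrite e' e exprS mulrA.
by rewrite -addnA.
Qed.

Lemma averaging_cvg x : rec x ->
  exists L : R, forall i, (x ^~ i @ \oo --> L)%classic.
Proof.
move=> hx; have [D sq] := averaging_squeeze _ hx.
(* Joint in times and states, so that the limit is the same for all states. *)
have small (e : R) : 0 < e -> exists N, forall n n' i i', (N <= n)%N -> (N <= n')%N ->
    `|x n i - x n' i'| < e.
  move=> e0; have : ((fun t => (1 - c) ^+ t * D) @ \oo --> (0 * D : R))%classic.
    apply: cvgMr_tmp; apply: cvg_expr; case/andP: gain_bounds => c0 c1.
    by rewrite ger0_norm ?subr_ge0// ltrBlDr ltrDl.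
  rewrite mul0r => /cvgrPdist_lt/(_ e e0)[t _ /(_ t (leqnn t))] /= h.
  have [l [u [N [lu xlu]]]] := sq t; exists N => n n' i i' Nn Nn'.
  have := xlu (n - N)%N i; have := xlu (n' - N)%N i'.
  rewrite !subnKC// => /andP[a b] /andP[a' b'].
  move: h; rewrite -lu sub0r normrN; apply: le_lt_trans.
  by rewrite [leRHS]ger0_norm ?ler_norml ?lerB ?opprB//; [apply/andP; split|]; lra.
have cv : (cvgn (x ^~ ord0)).
  apply/cauchy_cvgP/cauchy_ballP => e e0.
  have [N hN] := small e e0.
  pose A := (x ^~ ord0 @` [set n | (N <= n)%N])%classic.
  exists (A, A).
    by split; exists N => //= n Nn; exists n.
  by move=> [_ _] [[a Na <-] [b Nb <-]]; rewrite -ball_normE /=; exact: hN.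
exists (limn (x ^~ ord0)) => i; apply/cvgrPdist_lt => e e0.
have e20 : 0 < e / 2 by rewrite divr_gt0.
have [N hN] := small _ e20.
have /cvgrPdist_lt/(_ _ e20)[N' _ hN'] := cv.
exists (maxn N N') => //= n /=; rewrite geq_max => /andP[Nn N'n].
have := hN' n N'n; have := hN n n ord0 i Nn Nn => /= h1 h2.
rewrite (splitr e) -(subrKA (x n ord0)).
by rewrite (le_lt_trans (ler_normD _ _))// ltrD.
Qed.

End Averaging.

Lemma H_sum (R : realType) n (x : R) :
  H n x = 1 - \sum_(i < n) x ^+ i.+1 / (1 + x ^+ i.+1 - x ^+ n).
Proof. by rewrite /H big_add1 big_mkord. Qed.

Lemma is_derive_exprn (R : realType) n (x : R) :
  is_derive x 1 (fun y => y ^+ n) (n%:R * x ^+ n.-1).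
Proof.
apply: DeriveDef; first exact: exprn_derivable.
by rewrite exp_derive /GRing.scale /= mulr1.
Qed.

(** * The scaled counts as an averaging system *)

Section Asymptotics.
Variables (R : realType) (k : nat) (rho : R).
Local Notation m := k.+2.
Hypothesis rho01 : 0 < rho < 1.

Let p := rho ^+ m.
Let D (i : 'I_m) := 1 + rho ^+ i.+1 - p.
Let q (i : 'I_m) := rho ^+ i.+1 / D i.
Hypothesis sum_q : \sum_i q i = 1.

Lemma rho_pow_bounds : 0 < p < 1.
Proof. by case/andP: rho01 => r0 r1; rewrite exprn_gt0//= exprn_ilt1// ltW. Qed.

Lemma denom_gt0 i : 0 < D i.
Proof. by case/andP: rho01 => r0 r1; rewrite H_denom_gt0 ?ltn_ord ?ltW. Qed.

Lemma q_gt0 i : 0 < q i.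
Proof. by case/andP: rho01 => r0 r1; rewrite divr_gt0 ?exprn_gt0 ?denom_gt0. Qed.

Lemma onem_q i : 1 - q i = (1 - p) / D i.
Proof. by rewrite /q; have := lt0r_neq0 (denom_gt0 i); rewrite /D => ?; field. Qed.

Lemma onem_q_gt0 i : 0 < 1 - q i.
Proof. by rewrite onem_q divr_gt0 ?denom_gt0// subr_gt0; case/andP: rho_pow_bounds. Qed.

(** The numerator is at least p and the denominator below 2. This yields the lower bound on the
    off-diagonal weights. *)
Lemma q_ge i : p / 2 <= q i.
Proof.
case/andP: rho01 => r0 r1; case/andP: rho_pow_bounds => p0 p1.
have pr : p <= rho ^+ i.+1 by rewrite ler_wiXn2l ?ltW.
have r1' : rho ^+ i.+1 <= 1 by rewrite exprn_ile1 ?ltW.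
by rewrite ler_pdivlMr ?denom_gt0// /D; nra.
Qed.

(** Padding delays time by m, so [alpha] and [beta] carry an extra factor p = rho^m. *)
Let A n (i : 'I_m) : R := (count (starts m i.+1) (padded_compositions m n))%:R.
Let B n (i : 'I_m) : R :=
  (count (predC (starts m i.+1)) (padded_compositions m n))%:R.
Let alpha n i := A n i * rho ^+ n / q i.
Let beta n i := B n i * rho ^+ n / (1 - q i).

(** The choice of q gives rho^r (1 - q_r) / q_r = 1 - p, the coefficient of [beta]. *)
Lemma alpha_rec n i :
  alpha (n + m) i = p * alpha n i + (1 - p) * beta (n + (m - i.+1))%N i.
Proof.
rewrite /alpha /beta /A /B count_starts_rec// ?ltn_ord// natrD.
have -> : rho ^+ (n + m) = rho ^+ (n + (m - i.+1)) * rho ^+ i.+1.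
  by rewrite -exprD -addnA subnK.
rewrite mulrDl mulrDl; congr (_ + _).
  rewrite -exprD -addnA subnK// exprD -/p.
  by move: (_%:R) (rho ^+ n) p (q i)^-1 => a b c d; ring.
rewrite onem_q /q; have := lt0r_neq0 (denom_gt0 i) => D0.
have : 1 - p != 0 by case/andP: rho_pow_bounds => _ p1; rewrite gt_eqF// subr_gt0.
have : rho ^+ i.+1 != 0 by case/andP: rho01 => r0 _; rewrite gt_eqF// exprn_gt0.
by move: D0 (rho ^+ i.+1) => ? ? ? ?; field; apply/and3P.
Qed.

Lemma beta_split n i : (1 - q i) * beta n i =
  \sum_(s | s != i) q s * alpha n s + (n == m)%:R * p.
Proof.
have -> : (1 - q i) * beta n i = B n i * rho ^+ n.
  by rewrite [LHS]mulrC divfK// gt_eqF// onem_q_gt0.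
rewrite /B count_starts_disjoint// natrD natr_sum.
rewrite mulrDl mulr_suml; congr (_ + _).
  by apply: eq_bigr => s _; rewrite [RHS]mulrC divfK// gt_eqF// q_gt0.
by case: eqP => [->|]; rewrite ?mul0r.
Qed.

(** Obtained by substituting [beta_split] into [alpha_rec]; row sums are 1 - p by [sum_q]. *)
Let w i j := if j == i then 0 else (1 - p) * q j / (1 - q i).

Lemma sum_q_neq i : \sum_(s | s != i) q s = 1 - q i.
Proof. by rewrite -sum_q [in RHS](bigD1 i)//= addrC addrK. Qed.

Lemma weighted_sum i (f : 'I_m -> R) :
  \sum_j w i j * f j = (1 - p) / (1 - q i) * \sum_(j | j != i) q j * f j.
Proof.
rewrite (bigD1 i)//= /w eqxx mul0r add0r mulr_sumr.
by apply: eq_bigr => j /negPf ->; ring.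
Qed.

Lemma alpha_cvg : exists L : R, forall i, (alpha ^~ i @ \oo --> L)%classic.
Proof.
have /andP[p0 p1] := rho_pow_bounds.
(* Starting at [m.+1] removes the term n = m of [beta_split]. The bound p (1 - p) / 2 comes from
   [q_ge] and 1 - q_i < 1. *)
have [|||||||L hL] := @averaging_cvg R k p (p * (1 - p) / 2) w _ _ _ _ _ _
    (fun n => alpha (m.+1 + n)).
- exact: ltW.
- move=> i j; rewrite /w; case: eqP => // _.
  apply: divr_ge0; last exact/ltW/onem_q_gt0.
  by apply: mulr_ge0; [rewrite subr_ge0 ltW|exact/ltW/q_gt0].
- move=> i; under eq_bigr do rewrite -[w _ _]mulr1.
  rewrite weighted_sum; under eq_bigr do rewrite mulr1.
  by rewrite sum_q_neq divfK ?subrKC// gt_eqF// onem_q_gt0.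
- by rewrite divr_gt0// mulr_gt0// subr_gt0.
- by nra.
- move=> i j ij; rewrite /w eq_sym (negPf ij).
  rewrite ler_pdivlMr ?onem_q_gt0//.
  have h1 : 0 <= (1 - p) * (q j - p / 2).
    by rewrite mulr_ge0// subr_ge0; [exact: ltW|exact: q_ge].
  have h2 : 0 <= p * (1 - p) * q i.
    by apply/ltW; apply: mulr_gt0 (q_gt0 i); apply: mulr_gt0; rewrite ?subr_gt0.
  by move: (q i) (q j) h1 h2 => a b; lra.
- move=> n i; rewrite addnA alpha_rec weighted_sum; congr (_ + _).
  rewrite -mulrA; congr (_ * _); rewrite -addnA; set N := (_ + (_ + _))%N.
  apply: (@mulfI _ (1 - q i)); first by rewrite gt_eqF// onem_q_gt0.
  rewrite beta_split mulVKf; last by rewrite gt_eqF// onem_q_gt0.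
  by rewrite gtn_eqF ?mul0r ?addr0// /N; lia.
exists L => i; rewrite -(cvg_shiftn m.+1).
rewrite (_ : (fun n => _) = (fun n => alpha (m.+1 + n)%N i)); first exact: hL.
by apply/funext => n; rewrite addnC.
Qed.

Lemma beta_cvg (L : R) : (forall i, alpha ^~ i @ \oo --> L)%classic ->
  forall i, (beta ^~ i @ \oo --> L)%classic.
Proof.
move=> aL i; have q0 := lt0r_neq0 (onem_q_gt0 i).
have e : (\forall n \near \oo,
    (\sum_(s | s != i) q s * alpha n s) / (1 - q i) = beta n i)%classic.
  exists m.+1 => //= n mn; apply: (mulIf q0).
  by rewrite divfK// [RHS]mulrC beta_split gtn_eqF ?mul0r ?addr0.
apply: (cvg_trans (near_eq_cvg e)).
have <- : (\sum_(s | s != i) q s * L) / (1 - q i) = L.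
  by rewrite -mulr_suml sum_q_neq mulrAC divff ?mul1r.
apply: cvgMr_tmp; apply: cvg_big => [|s _]; first exact: add_continuous.
by apply: cvgMl_tmp; exact: aL.
Qed.

(** * The conserved quantity and the value of the limit *)

Let pi i := q i * (1 - q i).
(** The value of [mass] for alpha and beta constantly 1. *)
Let K := \sum_i pi i * (m%:R * p + i.+1%:R * (1 - p)).

(* Conserved for n > 0: pi is proportional to the stationary law of the residue
   classes, and the inner sums collect the values from which later terms are averaged. *)
Let mass n := \sum_i pi i * (p * \sum_(j < m) alpha (n + j) i +
   (1 - p) * \sum_(j < i.+1) beta (n + (m - i.+1) + j) i).

Lemma sum_shift (f : nat -> R) n l :
  \sum_(j < l) f (n.+1 + j)%N = \sum_(j < l) f (n + j)%N + f (n + l)%N - f n.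
Proof.
have : \sum_(j < l.+1) f (n + j)%N = \sum_(j < l) f (n + j)%N + f (n + l)%N.
  by rewrite big_ord_recr.
rewrite big_ord_recl /= addn0 => <-; rewrite addrC addKr.
by apply: eq_bigr => j _; rewrite addSnnS.
Qed.

(** Shifting the windows adds (1 - p) pi_i (beta_i - alpha_i) at time n + m. Summed over i these
    cancel, by the symmetry of q_i q_s, up to the empty composition, which enters at n = 0. *)
Lemma massS n : mass n.+1 = mass n + (n == 0%N)%:R * (p * (1 - p)).
Proof.
have -> : mass n.+1 = mass n + \sum_i (1 - p) * (pi i * (beta (n + m) i - alpha (n + m) i)).
  rewrite /mass -big_split /=; apply: eq_bigr => i _.
  rewrite (sum_shift (alpha ^~ i)) (_ : \sum_(j < i.+1) beta (n.+1 + _ + j)%N i =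
      \sum_(j < i.+1) beta ((n + (m - i.+1)).+1 + j)%N i)//.
  rewrite (sum_shift (beta ^~ i)) /= -addnA subnK// alpha_rec.
  move: (\sum_(j < m) _) (\sum_(j < i.+1) _) => s t; ring.
congr (_ + _); rewrite -mulr_sumr.
under eq_bigr do rewrite mulrBr {1}/pi -mulrA beta_split mulrDr.
rewrite sumrB big_split /= -mulr_suml sum_q mul1r.
rewrite -[X in _ == X]add0n eqn_add2r.
have -> : \sum_i q i * (\sum_(s | s != i) q s * alpha (n + m) s) =
          \sum_i pi i * alpha (n + m) i.
  under eq_bigr do rewrite mulr_sumr.
  rewrite (exchange_big_dep predT)//=; apply: eq_bigr => s _.
  rewrite /pi -sum_q_neq mulr_sumr mulr_suml.
  under eq_bigl do rewrite eq_sym.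
  by apply: eq_bigr => i _; ring.
by rewrite addrAC subrr add0r; ring.
Qed.

(** Both windows stay below index m, where no padded composition exists. *)
Lemma mass0 : mass 0 = 0.
Proof.
have pad0 n : (n < m)%N -> padded_compositions m n = [::].
  by rewrite /padded_compositions => ->.
rewrite /mass big1// => i _; rewrite !big1 ?mulr0 ?addr0 ?mulr0// => j _.
  rewrite /beta /B pad0 /= ?mul0r//; have := ltn_ord j; have := ltn_ord i; lia.
by rewrite /alpha /A pad0 ?add0n ?ltn_ord//= !mul0r.
Qed.

Lemma mass_const n : mass n.+1 = p * (1 - p).
Proof.
by elim: n => [|n IH]; rewrite massS ?mass0 ?IH/= ?add0r ?mul1r ?mul0r ?addr0.
Qed.

(** The limit L K of [mass] equals its constant value. *)
Lemma alpha_limit (L : R) : (forall i, alpha ^~ i @ \oo --> L)%classic ->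
  L * K = p * (1 - p).
Proof.
move=> aL; have bL := beta_cvg _ aL.
have shift (f : nat -> R) a : (f @ \oo --> L -> (fun n => f (n + a)%N) @ \oo --> L)%classic.
  by rewrite -(cvg_shiftn a).
have : (mass @ \oo --> L * K)%classic.
  rewrite /K mulr_sumr; apply: cvg_big => [|i _]; first exact: add_continuous.
  have -> : L * (pi i * (m%:R * p + i.+1%:R * (1 - p))) =
     pi i * (p * \sum_(j < m) L + (1 - p) * \sum_(j < i.+1) L).
    rewrite !sumr_const !card_ord -![L *+ _]mulr_natl.
    by move: (m%:R) (i.+1%:R) (pi i) p => a b c d; ring.
  apply: cvgMl_tmp; apply: cvgD; apply: cvgMl_tmp.
    apply: cvg_big => [|j _]; first exact: add_continuous.
    exact: (shift (alpha ^~ i)).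
  apply: cvg_big => [|j _]; first exact: add_continuous.
  under eq_cvg do rewrite -addnA.
  exact: (shift (beta ^~ i)).
rewrite -(cvg_shiftS mass) (_ : (fun n => _) = fun=> p * (1 - p)); last first.
  by apply/funext => n; rewrite /= mass_const.
by move=> /cvg_lim <-//; exact: lim_cst.
Qed.

Lemma num_succession_free_cvg :
  ((fun n => (num_succession_free m n)%:R * rho ^+ n * (K / (1 - p))) @ \oo
    --> (1 : R))%classic.
Proof.
have [L aL] := alpha_cvg; have bL := beta_cvg _ aL; have KL := alpha_limit _ aL.
have /andP[p0 p1] := rho_pow_bounds.
have limE : (q ord0 * L + (1 - q ord0) * L) * (K / (1 - p) / p) = 1.
  rewrite -mulrDl subrKC mul1r mulrA mulrA KL mulfK; last by rewrite gt_eqF// subr_gt0.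
  by rewrite divff// gt_eqF.
(* A class and its complement count all compositions; class [ord0] is an arbitrary choice. Dividing
   by p undoes the padding. *)
have e n : (num_succession_free m n)%:R * rho ^+ n * (K / (1 - p)) =
    (q ord0 * alpha (n + m) ord0 + (1 - q ord0) * beta (n + m) ord0) *
    (K / (1 - p) / p).
  rewrite /alpha /beta ![_ / (q _)]mulrC ![_ / (1 - q _)]mulrC.
  rewrite mulVKf ?gt_eqF ?q_gt0// mulVKf ?gt_eqF ?onem_q_gt0// -mulrDl -natrD.
  rewrite count_predC /padded_compositions ltnNge leq_addl /= addnK.
  rewrite -/(num_succession_free m n) exprD -/p.
  by field; rewrite gt_eqF//= gt_eqF// subr_gt0.
under eq_cvg do rewrite e.
suff : ((fun n => (q ord0 * alpha (n + m) ord0 + (1 - q ord0) * beta (n + m) ord0) *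
    (K / (1 - p) / p)) @ \oo --> (q ord0 * L + (1 - q ord0) * L) * (K / (1 - p) / p))%classic.
  by rewrite limE.
apply: cvgMr_tmp; apply: cvgD; apply: cvgMl_tmp.
  by have := aL ord0; rewrite -(cvg_shiftn m).
by have := bL ord0; rewrite -(cvg_shiftn m).
Qed.

(** Holds termwise: rho times the derivative of the i-th summand is rho^r (r (1 - p) + m p) / D_i^2
    with r = i + 1, and pi_i / (1 - p) = rho^r / D_i^2. *)
Lemma derive_H : - rho * ((H m)^`())%classic rho = K / (1 - p).
Proof.
have /andP[p0 p1] := rho_pow_bounds; have /andP[r0 r1] := rho01.
pose dh (i : 'I_m) := rho ^+ i.+1 *
    (- (D i) ^- 2 * (i.+1%:R * rho ^+ i - m%:R * rho ^+ m.-1)) +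
  (D i)^-1 * (i.+1%:R * rho ^+ i).
have hd (i : 'I_m) : is_derive rho 1
    (fun x : R => x ^+ i.+1 / (1 + x ^+ i.+1 - x ^+ m)) (dh i).
  have dD : is_derive rho 1 (fun x : R => 1 + x ^+ i.+1 - x ^+ m)
      (0 + i.+1%:R * rho ^+ i - m%:R * rho ^+ m.-1).
    apply: is_deriveB; last exact: is_derive_exprn.
    exact: is_deriveD (is_derive_cst _ _ _) (is_derive_exprn _ _ _).
  have dV := @is_deriveV _ (fun x : R => 1 + x ^+ i.+1 - x ^+ m) rho _ 1
    (lt0r_neq0 (denom_gt0 i)) dD.
  have := is_deriveM (is_derive_exprn _ i.+1 rho) dV.
  by rewrite add0r.
have dH : is_derive rho 1 (H m : R -> R) (0 - \sum_i dh i).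
  have -> : (H m : R -> R) = cst 1 -
      \sum_(i < m) (fun x : R => x ^+ i.+1 / (1 + x ^+ i.+1 - x ^+ m)).
    by apply/funext => x; rewrite H_sum fct_sumE.
  by apply: is_deriveB; exact: is_derive_sum.
rewrite derive1E derive_val sub0r mulrNN mulr_sumr /K mulr_suml.
apply: eq_bigr => i _; rewrite /pi onem_q /dh /q.
have -> : m%:R * rho ^+ m.-1 = m%:R * p / rho :> R.
  by rewrite /p [in RHS]exprS; field; rewrite gt_eqF.
have -> : rho ^+ i = rho ^+ i.+1 / rho by rewrite exprS mulrC mulKf// gt_eqF.
have := lt0r_neq0 (denom_gt0 i); rewrite /D => D0.
have : 1 - p != 0 by rewrite gt_eqF// subr_gt0.
have := lt0r_neq0 r0.
move: D0; move: p (rho ^+ i.+1) => P X D0 rn Pn.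
by field; apply/and3P.
Qed.

End Asymptotics.

(** * The case m = 1 and the conclusion *)

Lemma num_succession_free1 n : num_succession_free 1 n = 1%N.
Proof.
(* Modulo 1 all parts are congruent, so a nonempty composition has a single part; with padding it
   occurs for l > 1. *)
have cA l : count (starts 1 1) (padded_compositions 1 l) = (1 < l)%N.
  elim: l => [|l IH]; first by [].
  rewrite -[in LHS](addn1 l) count_starts_rec// IH subnn addn0.
  rewrite (count_starts_disjoint _ _ (@ord0 0))// big_pred0 ?add0n; last first.
    by move=> i; rewrite ord1.
  by case: l {IH} => [|[|l]].
have : num_succession_free 1 n = size (padded_compositions 1 n.+1).
  by rewrite /padded_compositions /= subn1.
rewrite -(count_predC (starts 1 1)) cA.
rewrite (count_starts_disjoint _ _ (@ord0 0))// big_pred0 ?add0n; last first.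
  by move=> i; rewrite ord1.
by case: n.
Qed.

Lemma asymp_equiv_scaled (R : realType) (a : nat -> nat) (r d : R) :
  ((fun n => (a n)%:R * r ^+ n * d) @ \oo --> (1 : R))%classic ->
  asymp_equiv (fun n => (a n)%:R) (fun n => r ^- n * (1 / d)).
Proof.
move=> h; rewrite /asymp_equiv; under eq_cvg do rewrite div1r invfM !invrK mulrA.
exact: h.
Qed.

Theorem mainTheorem7 (R : realType) (m : nat) (m_ge1 : (1 <= m)%N)
    (rho : R) (rhoP : is_smallest_positive_zero (H m) rho) :
  asymp_equiv (fun n => (num_succession_free m n)%:R)
    (fun n => rho ^- n * (1 / (- rho * ((H m)^`())%classic rho))).
Proof.
apply: asymp_equiv_scaled; case: rhoP => r0 Hr rmin.
case: m m_ge1 Hr rmin => [//|[|k]] _ Hr rmin.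
  have HE : H 1 = (fun x : R => 1 - x).
    by apply/funext => x; rewrite H_sum big_ord1 !expr1 addrK divr1.
  have r1 : rho = 1 by apply/eqP; move: Hr; rewrite HE => /eqP; rewrite subr_eq0 eq_sym.
  have -> : ((H 1)^`())%classic rho = -1.
    rewrite HE derive1E; have := is_deriveB (is_derive_cst (1 : R) rho 1) (is_derive_id rho 1).
    by move=> /@derive_val ->; rewrite sub0r.
  rewrite r1 mulrNN mulr1.
  under eq_cvg do rewrite num_succession_free1 expr1n !mulr1.
  exact: cvg_cst.
(* Some zero is at most 1, and H(1) = 1 - m is nonzero for m >= 2. *)
have rlt1 : rho < 1.
  have [r rle1 [rg0 Hr' _]] := @smallest_positive_zero_exists R k.+2 isT.
  rewrite lt_neqAle (le_trans (rmin r rg0 Hr') rle1) andbT.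
  apply/eqP => r1; move: Hr; rewrite r1 H_sum.
  under eq_bigr do rewrite !expr1n addrK divr1.
  rewrite sumr_const card_ord -[k.+2]addn1 mulrnDr opprD addrCA subrr addr0.
  by move/eqP; rewrite oppr_eq0 pnatr_eq0.
have rho01 : 0 < rho < 1 by rewrite r0.
have sum_q : \sum_(i < k.+2) rho ^+ i.+1 / (1 + rho ^+ i.+1 - rho ^+ k.+2) = 1.
  by apply/esym/eqP; rewrite -subr_eq0 -H_sum Hr.
by rewrite derive_H//; exact: num_succession_free_cvg.
Qed.
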